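(* Let $T$ be a reflexive tournament. Then $T$ is strongly chordal if and only if $T$ is isomorphic to the reflexive transitive tournament on $|V(T)|$ vertices.
   Context: A tournament is a digraph in which for every two distinct vertices $u,v$ exactly one of $uv, vu$ is an arc; it is reflexive if, in addition, every vertex has a loop. A transitive tournament is one with no directed cycle (loops excluded). A digraph $D$ is strongly chordal if its vertices can be ordered $v_1,\dots,v_n$ so that for all $i<j$ and $k<\ell$ ($i,j,k,\ell$ not necessarily all distinct), if $v_iv_k, v_iv_\ell, v_jv_k$ are arcs then $v_jv_\ell$ is an arc; equivalently, its adjacency matrix (with diagonal entry $1$ iff the vertex has a loop) admits a simultaneous row and column permutation with no submatrix $\begin{pmatrix}1&1\\1&0\end{pmatrix}$. *)

(* Defs.v *)
From mathcomp Require Import all_boot.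

Set Implicit Arguments.
Unset Strict Implicit.
Unset Printing Implicit Defensive.

(* Loops are unconstrained here; reflexivity is the separate hypothesis
   [reflexive e]. *)
Definition tournament (V : finType) (e : rel V) : Prop :=
  forall u v : V, u != v -> e u v (+) e v u.

(* Cycles on at least two distinct vertices, so loops do not count. *)
Definition no_directed_cycle (V : finType) (e : rel V) : Prop :=
  forall c : seq V, 1 < size c -> ~ ucycle e c.

Definition transitive_tournament (V : finType) (e : rel V) : Prop :=
  tournament e /\ no_directed_cycle e.

(* The index pairs (i, j) and (k, l) range over the same ordering v, and
   coincidences between a row index and a column index are allowed. *)
Definition strongly_chordal (V : finType) (e : rel V) : Prop :=
  exists2 v : 'I_#|V| -> V, bijective v &
    forall i j k l : 'I_#|V|, i < j -> k < l ->
      e (v i) (v k) -> e (v i) (v l) -> e (v j) (v k) -> e (v j) (v l).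

Definition digraph_isomorphic (V W : finType) (e : rel V) (f : rel W) : Prop :=
  exists2 phi : V -> W, bijective phi & forall x y : V, e x y = f (phi x) (phi y).

Definition reflexive_TT (n : nat) : rel 'I_n := fun i j => i <= j.

(* [reflexive_TT n] is a reflexive transitive tournament in the sense of the
   cycle-free definition above. *)
Lemma reflexive_TT_reflexive n : reflexive (@reflexive_TT n).
Proof. by move=> i; rewrite /reflexive_TT. Qed.

Lemma reflexive_TT_transitive n : transitive_tournament (@reflexive_TT n).
Proof.
split=> [i j | [|x [|y s]] //= _ /andP[/= /andP[le_xy p_y] /andP[x_notin _]]].
  by rewrite /reflexive_TT -val_eqE /=; case: ltngtP.
have tr : transitive (@reflexive_TT n) by move=> b a c; apply: leq_trans.
have le_yx : y <= x.
  move: p_y; rewrite path_sortedE // => /andP[/allP le_y _].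
  by apply: le_y; rewrite mem_rcons mem_head.
case/negP: x_notin; suff -> : x = y by apply: mem_head.
by apply/val_inj/eqP; rewrite eqn_leq le_yx andbT.
Qed.

(* Main.v *)
Require Import Defs.
From mathcomp Require Import all_boot.

(** If the ordering has no forbidden submatrix, look at a directed triangle
    [a -> b -> c -> a] whose first vertex in the ordering is [a]: the entries
    [aa], [ab], [ca] are all 1, so [cb] is 1 as well, contradicting [b -> c].
    Hence the tournament has no directed triangle, i.e. it is a total order, and
    counting strict predecessors is an isomorphism onto the standard one. *)

Lemma tournament_antisymmetric (V : finType) (T : rel V) :
  tournament T -> antisymmetric T.
Proof.
move=> tT x y /andP[Txy Tyx]; apply/eqP/negPn/negP => /tT.
by rewrite Txy Tyx.
Qed.

Lemma tournament_total (V : finType) (T : rel V) :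
  tournament T -> reflexive T -> total T.
Proof.
move=> tT rT x y; have [-> | /tT] := eqVneq x y; first by rewrite rT.
by case: (T x y).
Qed.

Lemma strongly_chordal_transitive (V : finType) (T : rel V) :
  tournament T -> reflexive T -> strongly_chordal T -> transitive T.
Proof.
move=> tT rT [v [w vK wK] scT].
have triangle_free (i j k : 'I_#|V|) : i < j -> i < k ->
    T (v i) (v j) -> T (v j) (v k) -> T (v k) (v i) -> j = k.
  move=> lt_ij lt_ik Tij Tjk Tki; apply: (can_inj vK).
  apply: (tournament_antisymmetric _ _ tT); rewrite Tjk.
  exact: scT lt_ik lt_ij (rT _) Tij Tki.
move=> y x z; rewrite -[x]wK -[y]wK -[z]wK.
move: (w x) (w y) (w z) => {x y z} i j k Tij Tjk.
(* By totality, failure of the wanted arc would close a directed triangle on [i], [j], [k]. *)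
have /orP[// | Tki] := tournament_total _ _ tT rT (v i) (v k).
have [eq_ij | ne_ij] := eqVneq i j; first by rewrite eq_ij.
have [<- // | ne_jk] := eqVneq j k.
have [<- // | ne_ik] := eqVneq i k.
(* Rotate the triangle to start at its least index; [triangle_free] then equates the other two
   indices, assumed distinct. *)
case: (ltngtP i j) => [lt_ij | lt_ji | /val_inj/eqP]; last by rewrite (negPf ne_ij).
- case: (ltngtP i k) => [lt_ik | lt_ki | /val_inj/eqP]; last by rewrite (negPf ne_ik).
  + by case/eqP: ne_jk; apply: (triangle_free i).
  + by case/eqP: ne_ij; apply: (triangle_free k) => //; apply: ltn_trans lt_ij.
- case: (ltngtP j k) => [lt_jk | lt_kj | /val_inj/eqP]; last by rewrite (negPf ne_jk).
  + by case/eqP: ne_ik; apply/esym/(triangle_free j).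
  + by case/eqP: ne_ij; apply: (triangle_free k) => //; apply: ltn_trans lt_ji.
Qed.

Lemma total_order_isomorphic (V : finType) (T : rel V) :
  reflexive T -> antisymmetric T -> transitive T -> total T ->
  digraph_isomorphic T (@reflexive_TT #|V|).
Proof.
move=> rT aT trT toT.
pose below x := [set y | T y x & y != x].
(* Since [x] is not in [below x], the rank fits in ['I_#|V|]. *)
have rank_lt x : #|below x| < #|V|.
  rewrite -cardsT; apply/proper_card/properP; split; first exact: subsetT.
  by exists x; rewrite ?inE ?eqxx ?andbF.
have rank_mono x y : T x y -> x != y -> #|below x| < #|below y|.
  move=> Txy ne_xy; apply/proper_card/properP; split; last first.
    by exists x; rewrite !inE ?eqxx ?andbF ?Txy.
  apply/subsetP=> z; rewrite !inE => /andP[Tzx ne_zx]; rewrite (trT x) //=.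
  (* If [z = y], the arcs [T z x] and [T x y] force [z = x] by antisymmetry. *)
  by apply: contra ne_zx => /eqP eq_zy; apply/eqP/aT; rewrite Tzx eq_zy Txy.
have rankE x y : T x y = (#|below x| <= #|below y|).
  have [<- | ne_xy] := eqVneq x y; first by rewrite rT leqnn.
  apply/idP/idP=> [Txy | le_xy]; first exact/ltnW/rank_mono.
  have /orP[// | Tyx] := toT x y.
  by have:= rank_mono y x Tyx; rewrite eq_sym ltnNge le_xy => /(_ ne_xy).
exists (fun x => Ordinal (rank_lt x)); last exact: rankE.
(* Equal ranks give arcs both ways by [rankE], so injectivity follows from antisymmetry. *)
apply: inj_card_bij; last by rewrite card_ord.
by move=> x y [eq_xy]; apply: aT; rewrite !rankE eq_xy leqnn.
Qed.

(** Ordering the vertices by the inverse isomorphism turns arcs into [<=] on indices, and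
    [j <= k < l] yields the required entry. *)
Lemma isomorphic_strongly_chordal (V : finType) (T : rel V) :
  digraph_isomorphic T (@reflexive_TT #|V|) -> strongly_chordal T.
Proof.
move=> [phi [v phiK vK] phiE]; exists v; first by exists phi.
move=> i j k l _ lt_kl; rewrite !phiE !vK /reflexive_TT => _ _ le_jk.
exact: leq_trans le_jk (ltnW lt_kl).
Qed.

Theorem theorem15 (V : finType) (T : rel V)
    (T_tournament : tournament T) (T_reflexive : reflexive T) :
  strongly_chordal T <-> digraph_isomorphic T (@reflexive_TT #|V|).
Proof.
split=> [scT | ]; last exact: isomorphic_strongly_chordal.
apply: total_order_isomorphic => //.
- exact: tournament_antisymmetric.
- exact: strongly_chordal_transitive.
- exact: tournament_total.
Qed.
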